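(* Let $G$ be a finite group of Lie type over $\mathbb{F}_q$ ($q$ a power of a prime $p$) with Borel subgroup $B$ and Weyl group $W$ generated by simple reflections $s_1,\dots,s_r$, and let $\mathbb{F}$ be a field of characteristic $p$. For every composition $\alpha$ of $r+1$, the multiplicity of the simple $H_W(0)$-module $\mathbf C_\alpha$ among the composition factors of the $H_W(0)$-module $1_B^G$ is \[ \sum_{w\in W:\ D(w^{-1})=D(\alpha)}q^{\ell(w)}. \]
   Context: $1_B^G=\overline B\cdot\mathbb{F} G$ is the $\mathbb{F}$-span of the right cosets of $B$ in $G$, where for $H\subseteq G$, $\overline H=\sum_{h\in H}h$. The $0$-Hecke algebra $H_W(0)$ is generated by $T_1,\dots,T_r$ with $T_i^2=-T_i$ and the braid relations of $W$, $T_w$ defined via reduced words; it acts on $1_B^G$ by $T_w(\overline Bg)=\overline{BwB}\,g$ for $g\in G$, $w\in W$ (this comes from the Hecke algebra $\mathrm{End}_{\mathbb{Z} G}(\overline B\mathbb{Z} G)$ specialized at $q=0$ in $\mathbb{F}$). $D(w)=\{i:\ell(ws_i)<\ell(w)\}$. Compositions $\alpha$ of $r+1$ correspond to subsets $D(\alpha)\subseteq[r]$ via partial sums. $\mathbf C_\alpha$ is the one-dimensional $H_W(0)$-module on which $T_i$ acts by $-1$ if $i\in D(\alpha)$ and by $0$ otherwise.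
   Formalization: ''Finite group of Lie type over F_q'' is taken to be a finite group with a split BN-pair in characteristic p such that |B s_i B| = q|B| for every i; this excludes twisted groups with other parameters, e.g. SU_3(q) (parameter q^3), for which the stated formula fails. *)

(* Defs.v *)
From HB Require Import structures.
From mathcomp Require Import all_boot all_order all_algebra all_fingroup.
From mathcomp Require Import pgroup.
Set Implicit Arguments. Unset Strict Implicit. Unset Printing Implicit Defensive.
Import GRing.Theory.

Section Weyl.
Variables (gT : finGroupType) (B N : {set gT}) (r : nat) (s : 'I_r -> gT).

Definition Tor : {set gT} := B :&: N.
Definition Weyl : {set coset_of Tor} := (N / Tor)%g.
(* the simple reflection s_{i+1} as an element of W (indices are 0-based) *)
Definition sW (i : 'I_r) : coset_of Tor := coset Tor (s i).

Definition wordW (t : seq 'I_r) : coset_of Tor := (\prod_(i <- t) sW i)%g.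

(* Coxeter length: least length of a word in s_1..s_r representing w
   (words of length < |W| suffice since S generates W). *)
Definition wlen (w : coset_of Tor) : nat :=
  \big[minn/#|Weyl|]_(k < #|Weyl|.+1 |
       [exists t : k.-tuple 'I_r, wordW t == w]) (k : nat).

Definition wdes (w : coset_of Tor) : {set 'I_r} :=
  [set i : 'I_r | wlen (w * sW i)%g < wlen w].
End Weyl.

Definition is_composition (m : nat) (a : seq nat) : bool :=
  all (fun x => 0 < x) a && (sumn a == m).

Definition psums (a : seq nat) : seq nat :=
  [seq sumn (take k a) | k <- iota 1 (size a).-1].

(* D(alpha) as a subset of [r] = {1..r}, encoded 0-based in 'I_r *)
Definition Dcomp (r : nat) (a : seq nat) : {set 'I_r} :=
  [set i : 'I_r | i.+1 \in psums a].

(* (G,B,N,S) is a Tits system with S = {s_1..s_r} (given by representatives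
   s i in N); split of characteristic p: B = U ><| T with U a normal p-subgroup,
   and the intersection of the N-conjugates of B is T; all parameters equal q:
   |B s B / B| = q for every simple reflection s. *)
Definition lie_type_BN (gT : finGroupType) (G B N : {group gT}) (r : nat)
    (s : 'I_r -> gT) (p q : nat) : Prop :=
  [/\ [/\ B \subset G, N \subset G & (G : {set gT}) = (<< B :|: N >>)%g],
      [/\ (Tor B N <| N)%g, (forall i, s i \in N)
        & (<< [set sW B N s i | i : 'I_r] >>)%g = Weyl B N],
      [/\ (forall i, #[sW B N s i]%g = 2), injective (sW B N s)
        & (forall i (n : gT), n \in N ->
            ((s i) *: (B :* n) \subset (B :* n) * B :|: (B :* (s i * n)) * B)%g)]
    & [/\ (forall i, (B :^ s i)%g != B),
          (forall i, #|(B * (s i *: B))%g| = (q * #|B|)%N),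
          (exists U : {group gT}, ((U ><| (Tor B N)) = B)%g /\ (p.-group U)%g)
        & (\bigcap_(n in N) (B :^ n))%g = Tor B N]].

Local Open Scope ring_scope.
Section Module.
Variables (F : fieldType) (gT : finGroupType) (G B : {group gT}) (r : nat)
          (s : 'I_r -> gT).

Definition ncos : nat := #|rcosets B G|.

(* the basis vector indexed by j is the coset sum  \overline{B} g  for the
   right coset enum_val j = B g *)
Definition coset_of_idx (j : 'I_ncos) : {set gT} := enum_val j.

(* matrix (acting on row vectors) of T_i :  \overline{B}g  |->
   \overline{B s_i B} g = sum of the right cosets contained in B s_i B g *)
Definition Tmat (i : 'I_r) : 'M[F]_ncos :=
  \matrix_(j, k) ((coset_of_idx k \subset (B * (s i *: B)) * coset_of_idx j)%g)%:R.

(* H_W(0)-submodules = subspaces stable under all T_i (T_w are products of T_i) *)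
Definition hsub (V : 'M[F]_ncos) : bool := [forall i, stablemx V (Tmat i)].

Definition comp_series (k : nat) (V : nat -> 'M[F]_ncos) : Prop :=
  [/\ (V 0%N == (0 : 'M[F]_ncos))%MS, (V k == (1%:M : 'M[F]_ncos))%MS,
      forall j, (j <= k)%N -> hsub (V j),
      forall j, (j < k)%N -> (V j < V j.+1)%MS
    & forall j, (j < k)%N -> forall U, hsub U -> (V j <= U)%MS -> (U <= V j.+1)%MS ->
         (U == V j)%MS || (U == V j.+1)%MS].

(* the factor V_{j+1}/V_j is isomorphic to C_D (the 1-dimensional module on
   which T_i acts by -1 if i in D and by 0 otherwise) *)
Definition factor_is_C (V : nat -> 'M[F]_ncos) (D : {set 'I_r}) (j : nat) : bool :=
  (\rank (V j.+1) == (\rank (V j)).+1) &&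
  [forall i, (V j.+1 *m (Tmat i - (if i \in D then -1 else 0)%:M) <= V j)%MS].

Definition mult_C (k : nat) (V : nat -> 'M[F]_ncos) (D : {set 'I_r}) : nat :=
  #|[set j : 'I_k | factor_is_C V D j]|.
End Module.

Arguments ncos {gT} G B.
Arguments coset_of_idx {gT} G B j.
Arguments Tmat {F gT} G B {r} s i.
Arguments hsub {F gT} G B {r} s V.
Arguments comp_series {F gT} G B {r} s k V.
Arguments factor_is_C {F gT} G B {r} s V D j.
Arguments mult_C {F gT} G B {r} s k V D.
Arguments Tor {gT} B N.
Arguments Weyl {gT} B N.
Arguments sW {gT} B N {r} s i.
Arguments wordW {gT} B N {r} s t.
Arguments wlen {gT} B N {r} s w.
Arguments wdes {gT} B N {r} s w.
Arguments lie_type_BN {gT} G B N {r} s p q.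

(* Main.v *)
(* Let P_J = B W_J B be a standard parabolic subgroup.  Modulo p the operator E_J
   sending a coset sum of B to the coset sum of P_J containing it is idempotent
   (|P_J : B| = 1 mod p), equals the sum of the T_u for u in W_J, and has rank
   |G : P_J|.  On a factor C_D it acts as 1 if D is disjoint from J and as 0
   otherwise; since ranks of an idempotent add up along a composition series,
   the number of factors C_D with D disjoint from J is |G : P_J|.  Counting
   Bruhat cells, |G : P_J| is also the sum of q^l(w) over the w with D(w^-1)
   disjoint from J, and comparing both for all J gives each multiplicity. *)
Require Import Defs.
From HB Require Import structures.
From mathcomp Require Import all_boot all_order all_algebra all_fingroup.
From mathcomp Require Import pgroup.
From mathcomp Require Import zify.
Set Implicit Arguments. Unset Strict Implicit. Unset Printing Implicit Defensive.
Import GRing.Theory.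

(** A composition series need not be compatible with any basis of coset sums, so its factors are
    reached through ranks alone. Matrices act on rows from the right: [M w *m M (sg i)] is T_w
    followed by T_i, which is T_{s_i w} or -T_w when q = 0. Hence left descents of w, that is
    D(w^-1), decide the eigenvalues. The exchange condition is not assumed: ascents are first
    defined by products of double cosets, the Tits axioms give their flipping and folding rules, and
    these yield exchange and the link with length. Cell sizes are counted over the integers;
    characteristic p enters through q = 0 in F. *)

Section DisjointSums.
Variables (I : finType) (f g : {set I} -> nat).

(* Disjointness from the complement of D means inclusion in D, so f D is
   determined by the sum over the subsets of D and the values at smaller sets. *)
Lemma eq_from_disjoint_sums :
    (forall J : {set I}, \sum_(D : {set I} | [disjoint D & J]) f D =
                         \sum_(D : {set I} | [disjoint D & J]) g D) ->
  forall D, f D = g D.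
Proof.
move=> fg D; have [n] := ubnP #|D|; elim: n D => // n IH D ltn.
have DD : [disjoint D & ~: D] by rewrite disjoints_subset setCK.
have := fg (~: D); rewrite (bigD1 D) // [RHS](bigD1 D) //=.
have -> : \sum_(D' : {set I} | [disjoint D' & ~: D] && (D' != D)) f D' =
          \sum_(D' : {set I} | [disjoint D' & ~: D] && (D' != D)) g D'.
  apply: eq_bigr => D' /andP[]; rewrite disjoints_subset setCK => sD nD.
  by apply: IH; apply: leq_trans (proper_card _) ltn; rewrite properEneq nD.
by move/addIn.
Qed.

(** Used with Q = disjointness from J, to bring both the multiplicities and the Weyl group sums into
    the form that [eq_from_disjoint_sums] compares. *)
Lemma sum_fibres (J : finType) (P : pred J) (p : J -> {set I}) (F : J -> nat)
    (Q : pred {set I}) :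
  \sum_(D | Q D) \sum_(j | P j && (p j == D)) F j = \sum_(j | P j && Q (p j)) F j.
Proof.
rewrite [RHS](partition_big p Q) => [|j /andP[] //].
apply: eq_bigr => D QD; apply: eq_bigl => j.
by case: eqP => [->|]; rewrite ?QD ?andbT ?andbF.
Qed.

End DisjointSums.

(** * Lengths and parabolic subgroups from the exchange condition *)

Section ExchangeLengths.
(* [asc i w] stands for l(s_i w) > l(w). *)
Variables (wT : finGroupType) (W : {group wT}) (r : nat) (sg : 'I_r -> wT).
Variables (len : wT -> nat) (asc : 'I_r -> wT -> bool).
Local Notation word t := (\prod_(i <- t) sg i)%g.

(** In a Tits system [asc] comes from double cosets, so it is not tied to [len] here; [ascE] derives
    the link from the flipping and folding rules. *)
Hypothesis sgW : forall i, sg i \in W.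
Hypothesis sg2 : forall i, (sg i * sg i = 1)%g.
Hypothesis len_word : forall t, len (word t) <= size t.
Hypothesis len_ex :
  forall w, w \in W -> exists2 t : seq 'I_r, (word t = w)%g & size t = len w.
Hypothesis asc1 : forall i, asc i 1%g.
Hypothesis asc_flip :
  forall i w, w \in W -> asc i w -> ~~ asc i (sg i * w)%g.
Hypothesis asc_fold : forall i j w, w \in W -> asc i w ->
  ~~ asc i (w * sg j)%g -> (sg i * w = w * sg j)%g.

Lemma word_rcons t i : (word (rcons t i) = word t * sg i)%g.
Proof. by rewrite -cats1 big_cat big_seq1. Qed.

Lemma word_in t : word t \in W.
Proof. by elim/big_ind: _ => // *; rewrite groupM. Qed.

Lemma sgKl i w : (sg i * (sg i * w) = w)%g.
Proof. by rewrite mulgA sg2 mul1g. Qed.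

Lemma sgV i : ((sg i)^-1 = sg i)%g.
Proof. by apply/eqP; rewrite eq_sym eq_mulgV1 invgK sg2. Qed.

(** Along the prefixes of t, ascent holds at the empty word and fails at the end. Where it first
    fails, folding moves s_i across the prefix and cancels the next letter. *)
Lemma exchange i t : ~~ asc i (word t) ->
  exists t1 j t2, t = t1 ++ j :: t2 /\ (sg i * word t = word (t1 ++ t2))%g.
Proof.
elim/last_ind: t => [|t j IH]; first by rewrite big_nil asc1.
rewrite word_rcons => nasc.
case: (boolP (asc i (word t))) => [a|/IH[t1 [k [t2 [-> e]]]]].
  exists t, j, [::]; rewrite cats0 cats1; split=> //.
  by rewrite mulgA (asc_fold (word_in t) a nasc) -mulgA sg2 mulg1.
exists t1, k, (rcons t2 j); rewrite -cats1 -catA /=; split=> //.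
  by rewrite cats1.
by rewrite mulgA e -word_rcons -cats1 -catA cats1.
Qed.

Lemma len1 : len 1%g = 0.
Proof. by apply/eqP; rewrite -leqn0; have := len_word [::]; rewrite big_nil. Qed.

Lemma len_eq0 w : w \in W -> len w = 0 -> w = 1%g.
Proof. by move=> /len_ex[t <- <-] /size0nil ->; rewrite big_nil. Qed.

Lemma lenS i w : w \in W -> len (sg i * w)%g <= (len w).+1.
Proof.
by move=> /len_ex[t <- <-]; have := len_word (i :: t); rewrite big_cons.
Qed.

(** Exchange erases a letter from a shortest word of w, so s_i w is shorter; [lenS] limits the drop
    to one. *)
Lemma desc_len i w : w \in W -> ~~ asc i w -> len w = (len (sg i * w)%g).+1.
Proof.
move=> wW na; apply/eqP; rewrite eqn_leq; apply/andP; split.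
  by rewrite -{1}(sgKl i w) lenS ?groupM.
have [t e sz] := len_ex wW; move: na; rewrite -e => /exchange[t1 [j [t2 [et ->]]]].
rewrite e -sz et !size_cat /= addnS ltnS -size_cat; exact: len_word.
Qed.

Lemma asc_len i w : w \in W -> asc i w -> len (sg i * w)%g = (len w).+1.
Proof.
move=> wW a; have := desc_len (groupM (sgW i) wW) (asc_flip wW a).
by rewrite sgKl => ->.
Qed.

Lemma ascE i w : w \in W -> asc i w = (len w < len (sg i * w)%g).
Proof.
move=> wW; case: (boolP (asc i w)) => [/(asc_len wW) -> |/(desc_len wW) ->].
  by rewrite ltnSn.
by rewrite ltnNge leqnSn.
Qed.

Lemma wordV t : ((word t)^-1 = word (rev t))%g.
Proof.
elim: t => [|i t IH]; first by rewrite !big_nil invg1.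
by rewrite rev_cons word_rcons big_cons invMg IH sgV.
Qed.

Lemma lenV w : w \in W -> len (w^-1)%g = len w.
Proof.
have le v : v \in W -> len (v^-1)%g <= len v.
  by move=> /len_ex[t <- <-]; rewrite wordV -size_rev len_word.
move=> wW; apply/eqP; rewrite eqn_leq le //=.
by rewrite -{1}(invgK w) le ?groupV.
Qed.

(** * Parabolic subgroups of W and shortest coset representatives *)

Section Parabolic.
Variable J : {set 'I_r}.
Definition parab := <<[set sg i | i in J]>>%g.
(** Meant as the shortest elements of the cosets W_J d, as [min_rep_shortest] confirms; the local
    form is the one that descent sets detect. *)
Definition min_reps := [set d in W | [forall i in J, asc i d]].

Canonical parab_group := Eval hnf in [group of parab].

Lemma parab_sub : parab \subset W.
Proof. by rewrite gen_subG; apply/subsetP => _ /imsetP[i _ ->]. Qed.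

Lemma sg_parab i : i \in J -> sg i \in parab.
Proof. by move=> iJ; apply/mem_gen/imset_f. Qed.

Lemma word_parab t : all (mem J) t -> word t \in parab.
Proof.
elim: t => [|i t IH] /=; first by rewrite big_nil group1.
by case/andP=> iJ /IH tJ; rewrite big_cons groupM // sg_parab.
Qed.

Lemma parab_word u : u \in parab -> exists2 t, all (mem J) t & (word t = u)%g.
Proof.
case/gen_prodgP => n [c cJ ->].
have /fin_all_exists[f fP] i : exists j, j \in J /\ c i = sg j.
  by have /imsetP[j] := cJ i; exists j.
exists [seq f i | i <- enum 'I_n].
  by apply/allP=> _ /mapP[i _ ->]; case: (fP i).
by rewrite big_map enumT; apply: eq_bigr => i _; case: (fP i).
Qed.

(** Minimal only among words in J; that no word in the other letters is shorter follows from
    [len_mul_shortest] at d = 1. *)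
Definition parab_reduced (t : seq 'I_r) := all (mem J) t /\
  forall t', all (mem J) t' -> (word t' = word t)%g -> size t <= size t'.

Lemma parab_reduced_ex u : u \in parab ->
  exists2 t, parab_reduced t & (word t = u)%g.
Proof.
move=> uJ; pose P n := [exists t : n.-tuple 'I_r, all (mem J) t && (word t == u)%g].
have exP : exists n, P n.
  have [t tJ e] := parab_word uJ; exists (size t); apply/existsP.
  by exists (in_tuple t); rewrite tJ /= e eqxx.
case: (ex_minnP exP) => n /existsP[t /andP[tJ /eqP e]] mn.
exists t => //; split=> // t' t'J; rewrite e size_tuple => e'.
by apply/mn/existsP; exists (in_tuple t'); rewrite t'J /= e' eqxx.
Qed.

Lemma parab_reduced_tail i t : parab_reduced (i :: t) -> parab_reduced t.
Proof.
case=> /= /andP[iJ tJ] mn; split=> // t' t'J e.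
by have := mn (i :: t'); rewrite /= iJ t'J !big_cons e => /(_ isT erefl).
Qed.

(* The letter given by the exchange condition can be erased neither from the
   word of [u], which is reduced, nor from that of [d], which is shortest. *)
Lemma len_mul_shortest t d : d \in W ->
    (forall u, u \in parab -> len d <= len (u * d)%g) -> parab_reduced t ->
  len (word t * d)%g = size t + len d.
Proof.
move=> dW dmin; elim: t => [|i t IH] red; first by rewrite big_nil mul1g.
have red' := parab_reduced_tail red.
have tJ := red'.1; have /= /andP[iJ _] := red.1.
have tdW : (word t * d)%g \in W by rewrite groupM ?word_in.
rewrite big_cons -mulgA; case: (boolP (asc i (word t * d)%g)) => [a|].
  by rewrite (asc_len tdW a) IH.
have [td ed sd] := len_ex dW.
rewrite -ed -big_cat /= => /exchange[t1 [j [t2 [ett e]]]].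
have et : size t1 + size t2 < size t + size td.
  by rewrite -(size_cat t) ett !size_cat /= addnS.
have := eqP (introT eqP ett).
case: (ltnP (size t1) (size t)) => st ee.
  (* Erased letter inside t: cancelling [td] leaves a word in J for s_i u, two letters shorter than
     [i :: t]. *)
  have t1E : t1 = take (size t1) t.
    by have := congr1 (take (size t1)) ee; rewrite [RHS]take_size_cat // takel_cat // ltnW.
  have dE : j :: t2 = drop (size t1) t ++ td.
    by have := congr1 (drop (size t1)) ee; rewrite [RHS]drop_size_cat // drop_cat st.
  have : size (drop (size t1) t) > 0 by rewrite size_drop subn_gt0.
  case dt: (drop (size t1) t) => [//|j' t3] _.
  move: dE; rewrite dt /= => -[_ t2E].
  have tE : t = t1 ++ j' :: t3 by rewrite {1}t1E -dt cat_take_drop.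
  have := red.2 (t1 ++ t3).
  rewrite all_cat.
  have : all (mem J) (t1 ++ j' :: t3) by rewrite -tE.
  rewrite all_cat /= => /and3P[-> _ ->] /(_ isT).
  have -> : (word (t1 ++ t3) = word (i :: t))%g.
    apply: (mulIg (word td)); rewrite -big_cat /= -catA -t2E -e.
    by rewrite big_cons big_cat /= mulgA.
  by move=> /(_ erefl); rewrite tE !size_cat /= addnS ltnNge leqnSn.
(* Erased letter inside [td]: with u = [word t], the element u^-1 s_i u of W_J sends d to a product
   of fewer than [len d] letters, against [dmin]. *)
pose n := size t1 - size t.
have t1E : t1 = t ++ drop (size t) t1.
  have := congr1 (take (size t)) ee.
  by rewrite take_size_cat // takel_cat // => {1}->; rewrite cat_take_drop.
move: e; rewrite t1E -catA !big_cat /= => e.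
have sdu : (((word t)^-1 * (sg i * word t)) * d = word (drop (size t) t1 ++ t2))%g.
  by rewrite -ed -!mulgA e mulKg big_cat.
have := dmin ((word t)^-1 * (sg i * word t))%g.
rewrite sdu !groupM ?groupV ?sg_parab ?word_parab // => /(_ isT) le.
have := leq_trans le (len_word _).
rewrite size_cat size_drop -sd => le2; exfalso; lia.
Qed.

Lemma min_repP d : d \in min_reps -> d \in W.
Proof. by rewrite inE => /andP[]. Qed.

Lemma shortest_ex w : w \in W -> exists u d,
  [/\ u \in parab, d \in W, w = (u * d)%g
    & forall v, v \in parab -> len d <= len (v * d)%g].
Proof.
move=> wW.
case: (arg_minnP (fun u => len (u * w)%g) (group1 [group of parab])) => u uJ mn.
exists (u^-1)%g, (u * w)%g; rewrite groupV mulKg; split=> //.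
  by rewrite groupM // (subsetP parab_sub _ uJ).
by move=> v vJ; rewrite mulgA; apply: mn; apply: groupM.
Qed.

(** Write d = u d0 with d0 shortest in its coset. A first letter i of a J-reduced word of u would
    make s_i d shorter than d, contrary to the ascent at i. *)
Lemma min_rep_shortest d : d \in min_reps ->
  forall u, u \in parab -> len d <= len (u * d)%g.
Proof.
rewrite inE => /andP[dW /forall_inP da].
have [u [d0 [uJ d0W ed d0m]]] := shortest_ex dW.
have [[|i t] red e] := parab_reduced_ex uJ.
  by rewrite ed -e big_nil mul1g.
have /= /andP[iJ _] := red.1.
have := da i iJ; rewrite ascE // ed -e (len_mul_shortest d0W d0m red).
rewrite big_cons -!mulgA sgKl (len_mul_shortest d0W d0m (parab_reduced_tail red)).
by rewrite /= addSn ltnNge leqnSn.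
Qed.

Lemma len_mul_min_rep u d : u \in parab -> d \in min_reps ->
  len (u * d)%g = len u + len d.
Proof.
move=> /parab_reduced_ex[t red <-] dm.
rewrite (len_mul_shortest (min_repP dm) (min_rep_shortest dm) red).
have := len_mul_shortest (group1 W) _ red; rewrite len1 addn0 mulg1 => -> //.
Qed.

(** Without a descent in J, u would be a minimal representative, and additivity of lengths in u^-1 u
    = 1 would force l(u) = 0. *)
Lemma parab_desc u : u \in parab -> u != 1%g -> exists2 i, i \in J & ~~ asc i u.
Proof.
move=> uJ u1; have uW := subsetP parab_sub _ uJ.
case: (boolP [exists i in J, ~~ asc i u]) => [/exists_inP[i]|na]; first by exists i.
case/negP: u1; apply/eqP/len_eq0 => //.
have um : u \in min_reps.
  rewrite inE uW; apply/forall_inP => i iJ.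
  by apply: contraNT na => na; apply/exists_inP; exists i.
have := @len_mul_min_rep (u^-1)%g u; rewrite groupV mulVg len1 => /(_ uJ um).
by move/esym/eqP; rewrite addn_eq0 => /andP[_ /eqP].
Qed.

Lemma sum_len_factor q : \sum_(w in W) q ^ len w =
  (\sum_(u in parab) q ^ len u) * \sum_(d in min_reps) q ^ len d.
Proof.
pose f (x : wT * wT) := (x.1 * x.2)%g.
have fW : f @: setX parab min_reps = W.
  apply/setP=> w; apply/imsetP/idP => [[[u d] /= /setXP[uJ dm] ->]|wW].
    by rewrite groupM ?(min_repP dm) // (subsetP parab_sub).
  have [u [d [uJ dW -> dmin]]] := shortest_ex wW; exists (u, d) => //.
  rewrite in_setX uJ inE dW; apply/forall_inP => i iJ.
  by apply: contraT => /(desc_len dW) e; have := dmin _ (sg_parab iJ); rewrite e ltnn.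
have finj : {in setX parab min_reps &, injective f}.
  move=> [u d] [u' d'] /setXP[/= uJ dm] /setXP[/= u'J d'm]; rewrite /f /= => e.
  (* v carries d to d' and v^-1 carries it back; adding lengths both ways leaves l(v) = 0. *)
  pose v := (u'^-1 * u)%g; have vJ : v \in parab by rewrite groupM ?groupV.
  have e1 : (v * d = d')%g by rewrite -mulgA e mulKg.
  have e2 : (v^-1 * d' = d)%g by rewrite -e1 mulKg.
  have l1 := len_mul_min_rep vJ dm.
  have := len_mul_min_rep (groupVr vJ) d'm; rewrite e2 -e1 l1 => l2.
  have v1 : v = 1%g by apply: len_eq0; [exact: subsetP parab_sub _ vJ | lia].
  rewrite v1 mul1g; congr pair.
  by apply/eqP; rewrite eq_sym eq_mulVg1 -/v v1.
rewrite -fW big_imset //= big_distrl /=.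
under [RHS]eq_bigr do rewrite big_distrr /=.
rewrite pair_big /=; apply: eq_big => [[u d]|[u d] /setXP[/= uJ dm]].
  by rewrite in_setX.
by rewrite /f /= len_mul_min_rep // expnD.
Qed.

End Parabolic.
End ExchangeLengths.

(** * Operators on coset sums of B *)

Section CosetMatrices.
Variables (gT : finGroupType) (G B : {group gT}).
Hypothesis sBG : B \subset G.
Implicit Types (X Y : {set gT}) (j k l : 'I_(ncos G B)).

Definition rep j : gT := repr (coset_of_idx G B j).

Lemma coset_of_idxE j : coset_of_idx G B j = (B :* rep j)%g.
Proof.
have /rcosetsP[x _ e] := enum_valP j.
by rewrite /rep /coset_of_idx e rcoset_repr.
Qed.

Lemma rep_in j : rep j \in G.
Proof.
have /rcosetsP[x xG e] := enum_valP j; rewrite /rep /coset_of_idx e.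
by case: repr_rcosetP => b bB; rewrite groupM // (subsetP sBG).
Qed.

Lemma rep_ex g : g \in G -> exists j b, b \in B /\ rep j = (b * g)%g.
Proof.
move=> gG; have gc : (B :* g)%g \in rcosets B G by apply/rcosetsP; exists g.
exists (enum_rank_in gc (B :* g)%g), (rep (enum_rank_in gc (B :* g)) * g^-1)%g.
rewrite mulgKV; split=> //; rewrite -mem_rcoset /rep /coset_of_idx enum_rankK_in //.
exact: mem_repr_rcoset.
Qed.

Lemma rep_inj j k : (rep j * (rep k)^-1)%g \in B -> j = k.
Proof.
rewrite -mem_rcoset => h; apply: enum_val_inj.
rewrite -[LHS]/(coset_of_idx G B j) -[RHS]/(coset_of_idx G B k) !coset_of_idxE.
exact/rcoset_eqP.
Qed.

Lemma rep_divE j k l :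
  (rep k * (rep j)^-1 = (rep k * (rep l)^-1) * (rep l * (rep j)^-1))%g.
Proof. by rewrite mulgA mulgKV. Qed.

Definition left_stable X := forall b x, b \in B -> x \in X -> (b * x)%g \in X.

Lemma card_reps X : X \subset G -> left_stable X ->
  (#|[set j | rep j \in X]| * #|B|)%N = #|X|.
Proof.
move=> sXG lX; rewrite -[RHS]sum1_card.
have -> : \sum_(x in X) 1 = \sum_(x in G | x \in X) 1.
  by apply: eq_bigl => x; rewrite andb_idl // => /(subsetP sXG).
rewrite (set_partition_big_cond _ (rcosets_partition sBG)) big_enum_val /=.
rewrite -sum1_card big_distrl /= big_mkcond; apply: eq_bigr => j _.
rewrite -[enum_val j]/(coset_of_idx G B j) inE coset_of_idxE.
case: ifP => jX.
  rewrite mul1n -(card_rcoset B (rep j)) -sum1_card; apply: eq_bigl => x.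
  rewrite andb_idr // => /rcosetP[b bB ->]; exact: lX.
rewrite big1 // => x /andP[/rcosetP[b bB ->]] bX.
by have := lX _ _ (groupVr bB) bX; rewrite mulKg jX.
Qed.

Section Ring.
Variable R : nzRingType.
Local Open Scope ring_scope.

(* For X a union of right cosets of B, this sends the sum over B g to the sum over X g. *)
Definition cmx X : 'M[R]_(ncos G B) :=
  \matrix_(j, k) ((rep k * (rep j)^-1)%g \in X)%:R.

Lemma mul_cmxE X Y j k : (cmx X *m cmx Y) j k =
  #|[set l | ((rep l * (rep j)^-1)%g \in X) && ((rep k * (rep l)^-1)%g \in Y)]|%:R.
Proof.
rewrite mxE -sum1_card natr_sum [RHS]big_mkcond; apply: eq_bigr => l _.
by rewrite !mxE inE -natrM mulnb; case: (_ && _).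
Qed.

Lemma cmxB : cmx B = 1%:M.
Proof.
apply/matrixP => j k; rewrite !mxE; congr (nat_of_bool _)%:R.
apply/idP/eqP => [/rep_inj -> //|->]; by rewrite mulgV group1.
Qed.

Lemma cmxU X Y : [disjoint X & Y] -> cmx (X :|: Y) = cmx X + cmx Y.
Proof.
move=> dXY; apply/matrixP => j k; rewrite !mxE inE -natrD.
set y := (_ * _)%g; case: (boolP (y \in X)) => [/(disjointFr dXY) ->//|//].
Qed.

(** An entry counts the cosets of B through which one passes by X and then by K. The last hypothesis
    leaves at most one, so the count is the indicator of K X; the order is reversed by the action on
    rows. *)
Lemma mul_cmx_unique X (K : {group gT}) :
    X \subset G -> left_stable X -> B \subset K -> K \subset G ->
    (forall h x, h \in K -> x \in X -> (h * x)%g \in X -> h \in B) ->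
  cmx X *m cmx K = cmx (K * X)%g.
Proof.
move=> sXG lX sBK sKG uniX; apply/matrixP => j k; rewrite mul_cmxE mxE; congr _%:R.
case: (boolP (_ \in _)) => [/mulsgP[h x hK xX e]|nKX].
  have xG : (x * rep j)%g \in G by rewrite groupM ?rep_in // (subsetP sXG).
  (* The intermediate coset is that of x [rep j], read off the factorisation h x. *)
  have [l0 [b [bB el0]]] := rep_ex xG.
  apply/eqP/cards1P; exists l0; apply/setP => l; rewrite !inE.
  have h1 : (rep l0 * (rep j)^-1)%g \in X by rewrite el0 mulgA mulgK lX.
  have h2 : (rep k * (rep l0)^-1)%g \in K.
    rewrite el0 !invMg !mulgA e mulgK groupM // groupV; exact: subsetP bB.
  apply/andP/eqP => [[l1 l2]|->//]; apply: rep_inj.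
  apply: (uniX _ (rep l0 * (rep j)^-1)%g); rewrite // -?rep_divE //.
  by rewrite (rep_divE l0 k l) groupMl in h2.
apply/eqP; rewrite cards_eq0; apply/eqP/setP => l; rewrite !inE.
apply: contraNF nKX => /andP[h1 h2]; rewrite (rep_divE j k l); exact: mem_mulg.
Qed.

(** Inside P every step through K is allowed, so a nonzero entry counts all cosets of B in one coset
    of K. *)
Lemma mul_cmx_group (K P : {group gT}) :
    B \subset K -> K \subset P -> P \subset G ->
  cmx K *m cmx P = #|K : B|%g%:R *: cmx P.
Proof.
move=> sBK sKP sPG; apply/matrixP => j k; rewrite mul_cmxE !mxE -natrM; congr _%:R.
case: (boolP (_ \in (P : {set gT}))) => yP; rewrite ?muln1 ?muln0; last first.
  apply/eqP; rewrite cards_eq0; apply/eqP/setP => l; rewrite !inE.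
  apply: contraNF yP => /andP[h1 h2]; rewrite (rep_divE j k l) groupM //.
  exact: subsetP h1.
have sKG := subset_trans sKP sPG.
rewrite -divgS // -(card_rcoset K (rep j)) -card_reps ?mulnK ?cardG_gt0 //.
- congr #|pred_of_set _|; apply/setP => l; rewrite !inE mem_rcoset andb_idr // => h.
  by rewrite -(groupMr _ (subsetP sKP _ h)) -rep_divE.
- by apply/subsetP => _ /rcosetP[x xK ->]; rewrite groupM ?rep_in // (subsetP sKG).
move=> b x bB; rewrite !mem_rcoset => xK.
by rewrite -mulgA groupM // (subsetP sBK).
Qed.

Lemma cmx_row_sum X : X \subset G -> left_stable X ->
  cmx X *m const_mx 1 = const_mx (#|X| %/ #|B|)%:R :> 'cV_(ncos G B).
Proof.
move=> sXG lX; apply/matrixP => j o; rewrite !mxE.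
rewrite -(card_rcoset X (rep j)) -card_reps ?mulnK ?cardG_gt0 //.
- rewrite -sum1_card natr_sum [RHS]big_mkcond; apply: eq_bigr => k _.
  by rewrite !mxE inE mulr1 mem_rcoset; case: (_ \in _).
- by apply/subsetP => _ /rcosetP[x xX ->]; rewrite groupM ?rep_in // (subsetP sXG).
by move=> b x bB; rewrite !mem_rcoset -mulgA; exact: lX.
Qed.

End Ring.

(** With A the incidence matrix of B-cosets against P-cosets, the operator is A A^T. Choosing a
    B-coset in each P-coset inverts A^T on the right, so the rank is the number of P-cosets over any
    field. *)
Lemma rank_cmx (F : fieldType) (P : {group gT}) :
  B \subset P -> P \subset G -> \rank (cmx F P) = #|G : P|%g.
Proof.
move=> sBP sPG; pose m := #|rcosets P G|.
pose A : 'M[F]_(ncos G B, m) :=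
  (\matrix_(j, c) (rep j \in (enum_val c : {set gT}))%:R)%R.
have cE (c : 'I_m) : exists2 x, x \in G & enum_val c = (P :* x)%g :> {set gT}.
  by have /rcosetsP[x xG ->] := enum_valP c; exists x.
have eqc (c d : 'I_m) g : g \in (enum_val c : {set gT}) ->
    g \in (enum_val d : {set gT}) -> c = d.
  move=> gc gd; apply: enum_val_inj; move: gc gd.
  have [x _ ->] := cE c; have [y _ ->] := cE d.
  by move=> /rcoset_eqP <- /rcoset_eqP <-.
have -> : cmx F P = (A *m A^T)%R.
  apply/matrixP => j k; rewrite !mxE.
  have jc : (P :* rep j)%g \in rcosets P G by apply/rcosetsP; exists (rep j); rewrite ?rep_in.
  pose c0 : 'I_m := enum_rank_in jc (P :* rep j)%g.
  have c0E : enum_val c0 = (P :* rep j)%g :> {set gT} by rewrite enum_rankK_in.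
  rewrite (bigD1 c0) //= !mxE c0E rcoset_refl mul1r mem_rcoset big1 ?addr0 // => c cc0.
  rewrite !mxE; case: (boolP (rep j \in _)) => [jc'|]; last by rewrite mul0r.
  by case/eqP: cc0; apply: eqc jc' _; rewrite c0E rcoset_refl.
have fA : row_free A^T.
  have /fin_all_exists[f fP] (c : 'I_m) : exists j, rep j \in (enum_val c : {set gT}).
    have [x xG ->] := cE c; have [j [b [bB e]]] := rep_ex xG.
    by exists j; rewrite e mem_rcoset mulgK (subsetP sBP).
  apply/row_freeP; exists (\matrix_(j, c) (j == f c)%:R)%R.
  apply/matrixP => c d; rewrite !mxE (bigD1 (f d)) //= !mxE eqxx mulr1.
  rewrite big1 ?addr0 => [|j /negbTE jd]; last by rewrite !mxE jd mulr0.
  congr (nat_of_bool _)%:R%R; apply/idP/eqP => [h|->]; last exact: fP.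
  exact: eqc h (fP d).
by rewrite mxrankMfree // -mxrank_tr; move/eqP: fA.
Qed.

End CosetMatrices.

(** * Bruhat decomposition *)

Section BigMin.
Variables (I : finType) (x0 : nat) (P : pred I) (F : I -> nat).

Lemma bigmin_leq i : P i -> \big[minn/x0]_(j | P j) F j <= F i.
Proof.
move=> Pi; have := mem_index_enum i.
elim: (index_enum I) => [//|j l IH]; rewrite in_cons big_cons => /orP[/eqP <-|il].
  by rewrite Pi geq_minl.
by case: (P j); rewrite ?geq_min IH ?orbT.
Qed.

Lemma bigmin_leq_idx : \big[minn/x0]_(j | P j) F j <= x0.
Proof. by elim/big_rec: _ => // i m _ le; rewrite geq_min le orbT. Qed.

Lemma bigmin_attained : \big[minn/x0]_(j | P j) F j = x0 \/
  exists2 i, P i & \big[minn/x0]_(j | P j) F j = F i.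
Proof.
elim/big_rec: _ => [|i m Pi IH]; first by left.
by case: (leqP (F i) m) => _; [right; exists i | ].
Qed.
End BigMin.

Section TitsSystem.
Variables (gT : finGroupType) (G B N : {group gT}) (r : nat) (s : 'I_r -> gT).
Hypothesis sBG : B \subset G.
Hypothesis sNG : N \subset G.
Hypothesis genG : (G : {set gT}) = (<< B :|: N >>)%g.
Hypothesis nTN : (Tor B N <| N)%g.
Hypothesis sN : forall i, s i \in N.
Hypothesis genW : (<< [set sW B N s i | i : 'I_r] >>)%g = Weyl B N.
Hypothesis order_sW : forall i, #[sW B N s i]%g = 2.
Hypothesis tits : forall i (n : gT), n \in N ->
  ((s i) *: (B :* n) \subset (B :* n) * B :|: (B :* (s i * n)) * B)%g.
Hypothesis sBs : forall i, (B :^ s i)%g != B.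

Local Notation W := (Weyl B N).
Local Notation sg := (sW B N s).
Local Notation T := (Tor B N).

Definition weyl_group : {group coset_of T} := (N / (B :&: N))%G.

Lemma Tor_norm n : n \in N -> n \in 'N(T)%g.
Proof. by move/(subsetP (normal_norm nTN)). Qed.

Lemma cosetW n : n \in N -> coset T n \in W.
Proof. by move=> nN; apply: mem_quotient. Qed.

Lemma cosetM n m : n \in N -> m \in N -> coset T (n * m) = (coset T n * coset T m)%g.
Proof. by move=> nN mN; rewrite morphM //; apply: Tor_norm. Qed.

Lemma Weyl_ex w : w \in W -> exists2 n, n \in N & w = coset T n.
Proof. by case/morphimP => n _ nN ->; exists n. Qed.

Lemma sWW i : sg i \in weyl_group.
Proof. exact: cosetW. Qed.

Lemma sWM i : (sg i * sg i = 1)%g.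
Proof. by have := expg_order (sg i); rewrite order_sW. Qed.

Lemma sW_neq1 i : sg i != 1%g.
Proof. by rewrite -order_eq1 order_sW. Qed.

Lemma wordW_in t : wordW B N s t \in weyl_group.
Proof. by rewrite /wordW; elim/big_ind: _ => // *; rewrite ?groupM ?sWW. Qed.

Lemma wordW_cat t1 t2 :
  wordW B N s (t1 ++ t2) = (wordW B N s t1 * wordW B N s t2)%g.
Proof. exact: big_cat. Qed.

(** Prefixes of a shortest word have distinct values, since the segment between two equal ones could
    be cut out. This keeps shortest words within the range searched by [wlen], below its default. *)
Lemma shortest_word_bound t :
    (forall t', wordW B N s t' = wordW B N s t -> size t <= size t') ->
  size t < #|W|.
Proof.
move=> mn; pose f (k : 'I_(size t).+1) := wordW B N s (take k t).
have finj : injective f.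
  suff lt (k l : 'I_(size t).+1) : k < l -> f k <> f l.
    by move=> k l e; apply: val_inj; case: (ltngtP k l) => // /lt; rewrite e.
  move=> kl e; have := mn (take k t ++ drop l t).
  rewrite wordW_cat [wordW _ _ _ (take k t)]e -wordW_cat cat_take_drop.
  move=> /(_ erefl); rewrite size_cat size_takel ?size_drop; last by rewrite -ltnS.
  by have := ltn_ord l; lia.
rewrite -[X in X <= _]card_ord -(card_imset _ finj) subset_leq_card //.
by apply/subsetP => _ /imsetP[k _ ->]; exact: wordW_in.
Qed.

Lemma wlen_word t : wlen B N s (wordW B N s t) <= size t.
Proof.
case: (leqP (size t) #|W|) => le; last exact: leq_trans (bigmin_leq_idx _ _ _) (ltnW le).
have lt : size t < #|W|.+1 by [].
apply: (@bigmin_leq _ _ _ _ (Ordinal lt)).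
by apply/existsP; exists (in_tuple t).
Qed.

Lemma wlen_ex w : w \in weyl_group ->
  exists2 t : seq 'I_r, wordW B N s t = w & size t = wlen B N s w.
Proof.
move=> wW; pose P n := [exists t : n.-tuple 'I_r, wordW B N s t == w].
have exP : exists n, P n.
  have : w \in W := wW; rewrite -genW => /gen_prodgP[n [c cS ew]].
  have /fin_all_exists[f fP] i : exists j, c i = sg j.
    by have /imsetP[j] := cS i; exists j.
  exists n; apply/existsP; exists (map_tuple f (ord_tuple n)); apply/eqP.
  rewrite ew /wordW /= big_map enumT.
  by apply: eq_bigr => i _; rewrite fP.
case: (ex_minnP exP) => n /existsP[t /eqP e] mn.
exists t => //; apply/eqP; rewrite eqn_leq andbC -{1}e wlen_word.
have /ltnW lt : size t < #|W|.
  apply: shortest_word_bound => t' e'; rewrite size_tuple; apply/mn/existsP.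
  by exists (in_tuple t'); rewrite /= e' e.
rewrite /wlen; case: (bigmin_attained #|W|
  (fun k : 'I_#|W|.+1 => [exists t : k.-tuple 'I_r, wordW B N s t == w])
  (fun k => k : nat)) => [->|[k Pk ->]]; first exact: lt.
by rewrite size_tuple mn.
Qed.

Definition dcoset (w : coset_of T) : {set gT} := (B * (w : {set gT}) * B)%g.

Lemma dcoset_coset n : n \in N -> dcoset (coset T n) = (B :* n * B)%g.
Proof.
move=> nN; rewrite /dcoset (@val_coset _ (B :&: N)%G) ?Tor_norm // mulgA mulGSid //.
exact: subsetIl.
Qed.

Lemma dcoset_cosetP n x : n \in N ->
  reflect (exists b c, [/\ b \in B, c \in B & x = (b * n * c)%g])
          (x \in dcoset (coset T n)).
Proof.
move=> nN; rewrite dcoset_coset //; apply: (iffP mulsgP).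
  by case=> _ c /rcosetP[b bB ->] cB ->; exists b, c.
case=> b [c [bB cB ->]]; exists (b * n)%g c => //.
by rewrite mem_rcoset mulgK.
Qed.

Lemma mem_dcoset n : n \in N -> n \in dcoset (coset T n).
Proof. by move=> nN; apply/dcoset_cosetP=> //; exists 1%g, 1%g; rewrite mul1g mulg1. Qed.

Lemma mem_dcoset_sW i : s i \in dcoset (sg i).
Proof. exact: mem_dcoset. Qed.

Lemma dcosetMl w b x : b \in B -> x \in dcoset w -> (b * x)%g \in dcoset w.
Proof.
move=> bB xw; have <- : (B * dcoset w = dcoset w)%g by rewrite /dcoset !mulgA mulGid.
exact: mem_mulg.
Qed.

Lemma dcosetMr w b x : b \in B -> x \in dcoset w -> (x * b)%g \in dcoset w.
Proof.
move=> bB xw; have <- : (dcoset w * B = dcoset w)%g by rewrite /dcoset -mulgA mulGid.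
exact: mem_mulg.
Qed.

Lemma dcosetV w x : w \in W -> x \in dcoset w -> (x^-1)%g \in dcoset w^-1%g.
Proof.
move=> /Weyl_ex[n nN ->] /(dcoset_cosetP _ nN)[b [c [bB cB ->]]].
rewrite -morphV ?Tor_norm //; apply/dcoset_cosetP; rewrite ?groupV //.
by exists c^-1%g, b^-1%g; rewrite !groupV !invMg mulgA.
Qed.

Lemma dcoset1 : dcoset 1 = B.
Proof.
by rewrite -(morph1 (coset_morphism T)) dcoset_coset // mulg1 mulGid.
Qed.

Lemma dcoset_eq w x y : w \in W -> x \in dcoset w -> y \in dcoset w ->
  exists b c, [/\ b \in B, c \in B & y = (b * x * c)%g].
Proof.
move=> /Weyl_ex[n nN ->] /(dcoset_cosetP _ nN)[b [c [bB cB ->]]].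
move=> /(dcoset_cosetP _ nN)[b' [c' [b'B c'B ->]]].
exists (b' * b^-1)%g, (c^-1 * c')%g; rewrite !groupM ?groupV //; split=> //.
by rewrite !mulgA mulgKV mulgK.
Qed.

Lemma dcoset_split u w x : u \in W -> w \in W -> x \in dcoset (u * w)%g ->
  exists y z, [/\ y \in dcoset u, z \in dcoset w & x = (y * z)%g].
Proof.
move=> /Weyl_ex[n nN ->] /Weyl_ex[m mN ->]; rewrite -cosetM //.
move/dcoset_cosetP => /(_ (groupM nN mN))[b [c [bB cB ->]]].
exists (b * n)%g, (m * c)%g; rewrite dcosetMl ?dcosetMr ?mem_dcoset //.
by rewrite !mulgA.
Qed.

Lemma dcosetM_sW i w x y : w \in W -> x \in dcoset (sg i) -> y \in dcoset w ->
  (x * y)%g \in dcoset w \/ (x * y)%g \in dcoset (sg i * w)%g.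
Proof.
move=> /Weyl_ex[n nN ->] /(dcoset_cosetP _ (sN i))[b [c [bB cB ->]]].
move=> /(dcoset_cosetP _ nN)[b' [c' [b'B c'B ->]]].
have : (s i * (c * b' * n))%g \in (s i *: (B :* n))%g.
  by rewrite mem_lcoset mulKg mem_rcoset mulgK groupM.
move/(subsetP (tits i nN)); rewrite in_setU -cosetM // !dcoset_coset ?groupM //.
have -> : (b * s i * c * (b' * n * c') = b * (s i * (c * b' * n)) * c')%g.
  by rewrite !mulgA.
by case/orP=> xy; [left | right]; rewrite -dcoset_coset ?groupM // dcosetMr // dcosetMl //;
   rewrite dcoset_coset ?groupM.
Qed.

(** Mirror image of [dcosetM_sW] under inversion. *)
Lemma dcosetM_sWr i w x y : w \in W -> x \in dcoset w -> y \in dcoset (sg i) ->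
  (x * y)%g \in dcoset w \/ (x * y)%g \in dcoset (w * sg i)%g.
Proof.
move=> wW xw ys; have sV : ((sg i)^-1 = sg i)%g := sgV sWM i.
have := dcosetV (sWW i) ys; rewrite sV => ysV.
have wVW : (w^-1)%g \in W by rewrite (@groupV _ weyl_group).
have := dcosetM_sW wVW ysV (dcosetV wW xw); rewrite -invMg.
case=> xy; [left|right]; rewrite -[(x * y)%g]invgK.
  by rewrite -[w]invgK dcosetV.
by rewrite -[w]invgK -sV -invMg dcosetV // (@groupM _ weyl_group) ?sWW.
Qed.

(** Induction on the smaller length. For w = s_i u, dividing by s_i puts a representative of u in
    the cell of w' or of s_i w'. The first gives u = w', too short; the second gives u = s_i w', the
    induction applying since l(u) < l(w) <= l(w') <= l(s_i w') + 1. *)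
Lemma dcoset_inj w w' x : w \in W -> w' \in W ->
  x \in dcoset w -> x \in dcoset w' -> w = w'.
Proof.
wlog le : w w' / wlen B N s w <= wlen B N s w'.
  move=> H wW w'W xw xw'.
  by case/orP: (leq_total (wlen B N s w) (wlen B N s w')) => le; [|apply/esym];
    apply: H.
have [n] := ubnP (wlen B N s w); elim: n w w' x le => // n IH w w' x le ltn wW w'W xw xw'.
have [t ew sz] := wlen_ex wW.
case: t ew sz => [|i t] ew sz.
  rewrite -ew /wordW big_nil; move: xw; rewrite -ew /wordW big_nil dcoset1 => xB.
  have [m mN em] := Weyl_ex w'W; move: xw'; rewrite em.
  case/(dcoset_cosetP _ mN) => b [c [bB cB e]].
  rewrite coset_id // inE mN andbT.
  by rewrite -(groupMl _ bB) -(groupMr _ cB) -e.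
have ewi : w = (sg i * wordW B N s t)%g by rewrite -ew /wordW big_cons.
have uW : wordW B N s t \in W := wordW_in t.
have [m mN em] := Weyl_ex uW.
have : (s i * m)%g \in dcoset w' .
  have : (s i * m)%g \in dcoset w.
    by rewrite ewi em -cosetM // mem_dcoset // groupM.
  case/(dcoset_eq wW xw) => b [c [bB cB ->]].
  by rewrite dcosetMr // dcosetMl.
have := dcosetV (sWW i) (mem_dcoset_sW i); rewrite (sgV sWM) => sVs.
move/(dcosetM_sW w'W sVs); rewrite mulKg.
have mu : m \in dcoset (wordW B N s t) by rewrite em mem_dcoset.
have lu : wlen B N s (wordW B N s t) < wlen B N s w by rewrite -sz ltnS wlen_word.
have lun : wlen B N s (wordW B N s t) < n := leq_trans lu ltn.
have lw : wlen B N s w' <= (wlen B N s (sg i * w')%g).+1.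
  have := lenS wlen_word wlen_ex i (groupM (sWW i) w'W).
  by rewrite (sgKl sWM).
case=> mw.
  have e := IH _ _ _ (leq_trans (ltnW lu) le) lun uW w'W mu mw.
  by move: le; rewrite -e leqNgt lu.
have le' : wlen B N s (wordW B N s t) <= wlen B N s (sg i * w')%g.
  by rewrite -ltnS; apply: leq_trans lu (leq_trans le lw).
by rewrite ewi (IH _ _ _ le' lun uW (groupM (sWW i) w'W) mu mw) (sgKl sWM).
Qed.

(* Meaning B s_i B w B = B s_i w B, i.e. the length goes up. *)
Definition asc i w :=
  ~~ [exists x in dcoset (sg i), exists y in dcoset w, (x * y)%g \in dcoset w].

Lemma ascP i w : reflect
  (forall x y, x \in dcoset (sg i) -> y \in dcoset w -> (x * y)%g \notin dcoset w)
  (asc i w).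
Proof.
apply: (iffP idP) => [na x y xs yw|na].
  apply: contra na => xy; apply/exists_inP; exists x => //.
  by apply/exists_inP; exists y.
by apply/negP => /exists_inP[x xs /exists_inP[y yw]]; apply/negP/na.
Qed.

Lemma ascN i w : ~~ asc i w -> exists x y,
  [/\ x \in dcoset (sg i), y \in dcoset w & (x * y)%g \in dcoset w].
Proof. by rewrite negbK => /exists_inP[x xs /exists_inP[y yw xy]]; exists x, y. Qed.

Lemma asc_mul i w x y : w \in W -> asc i w ->
  x \in dcoset (sg i) -> y \in dcoset w -> (x * y)%g \in dcoset (sg i * w)%g.
Proof.
move=> wW /ascP a xs yw; have := a x y xs yw => na.
by case: (dcosetM_sW wW xs yw) => //; rewrite (negbTE na).
Qed.

Lemma asc_id i : asc i 1%g.
Proof.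
apply/ascP => x y xs; rewrite dcoset1 => yB; rewrite groupMr //.
apply: contra (sW_neq1 i) => xB; apply/eqP.
by apply: (@dcoset_inj _ _ x); rewrite ?dcoset1 // ?sWW // (group1 weyl_group).
Qed.

(** As B^s differs from B, some s^-1 b s lies outside B; a product of two elements of BsB, it must
    lie in BsB. *)
Lemma sW_square i : exists x y,
  [/\ x \in dcoset (sg i), y \in dcoset (sg i) & (x * y)%g \in dcoset (sg i)].
Proof.
have ss := mem_dcoset_sW i.
have ssV : (s i)^-1%g \in dcoset (sg i) by have := dcosetV (sWW i) ss; rewrite (sgV sWM).
have : ~~ (B :^ s i \subset B)%g.
  by apply: contra (sBs i) => sub; rewrite eqEcard sub cardJg leqnn.
case/subsetPn => _ /imsetP[b bB ->] nb.
have bs : (b * s i)%g \in dcoset (sg i) by apply: dcosetMl.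
exists (s i)^-1%g, (b * s i)%g; split=> //.
have := dcosetM_sW (sWW i) ssV bs; rewrite sWM dcoset1 -conjgE.
by case=> //; rewrite (negbTE nb).
Qed.

(** If both steps ascended, a product x y n with x, y and x y in B s_i B would lie in the cell of
    s_i s_i w = w and in that of s_i w, according to the bracketing. *)
Lemma asc_flip i w : w \in W -> asc i w -> ~~ asc i (sg i * w)%g.
Proof.
move=> wW a; apply/negP => a'.
have [x [y [xs ys xys]]] := sW_square i.
have [n nN en] := Weyl_ex wW.
have nw : n \in dcoset w by rewrite en mem_dcoset.
have swW : (sg i * w)%g \in W := groupM (sWW i) wW.
have h1 := asc_mul swW a' xs (asc_mul wW a ys nw).
have h2 := asc_mul wW a xys nw.
rewrite mulgA (sgKl sWM) in h1.
have e := dcoset_inj wW swW h1 h2.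
by have /eqP := sW_neq1 i; apply; apply: (mulIg w); rewrite mul1g -e.
Qed.

(** Split y = z v along w s_j. Then x z lies in the cell of s_i w; being x y v^-1, it also lies in
    that of w s_j or of w, and the latter would give s_i = 1. *)
Lemma asc_fold i j w : w \in W -> asc i w ->
  ~~ asc i (w * sg j)%g -> (sg i * w = w * sg j)%g.
Proof.
move=> wW a /ascN[x [y [xs yw xyw]]].
have wsW : (w * sg j)%g \in W := groupM wW (sWW j).
have swW : (sg i * w)%g \in W := groupM (sWW i) wW.
have [z [v [zw vs ey]]] := dcoset_split wW (sWW j) yw.
have h1 := asc_mul wW a xs zw.
have vVs : v^-1%g \in dcoset (sg j) by have := dcosetV (sWW j) vs; rewrite (sgV sWM).
have := dcosetM_sWr wsW xyw vVs; rewrite ey mulgA mulgK -mulgA sWM mulg1.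
case=> h2; first exact: dcoset_inj swW wsW h1 h2.
have e := dcoset_inj swW wW h1 h2.
by have /eqP := sW_neq1 i; case; apply: (mulIg w); rewrite mul1g.
Qed.

(** * Standard parabolic subgroups of G *)

Section ParabolicSubgroup.
Variable J : {set 'I_r}.
Local Notation WJ := (parab sg J).

Definition Parab := \bigcup_(u in WJ) dcoset u.

Lemma parabW u : u \in WJ -> u \in W.
Proof. exact: (subsetP (parab_sub sWW J)). Qed.

Lemma ParabP x : reflect (exists2 u, u \in WJ & x \in dcoset u) (x \in Parab).
Proof. exact: bigcupP. Qed.

Lemma Parab_group_set : group_set Parab.
Proof.
apply/group_setP; split.
  by apply/ParabP; exists 1%g; rewrite ?dcoset1 ?group1.
move=> x y /ParabP[_ /parab_word[t tJ <-] xt] yP.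
elim: t tJ x xt => [_ x|i t IH /= /andP[iJ tJ] x].
  rewrite big_nil dcoset1 => xB; have /ParabP[u uJ yu] := yP.
  by apply/ParabP; exists u; rewrite ?dcosetMl.
rewrite big_cons => /(dcoset_split (sWW i) (wordW_in t))[x1 [x2 [x1s x2t ->]]].
rewrite -mulgA; have /ParabP[u uJ yu] := IH tJ _ x2t.
have uW := parabW uJ.
case: (dcosetM_sW uW x1s yu) => h; apply/ParabP; first by exists u.
by exists (sg i * u)%g; rewrite // groupM // sg_parab.
Qed.

Canonical Parab_group := group Parab_group_set.

Lemma sub_Parab : B \subset Parab.
Proof.
by apply/subsetP => x xB; apply/ParabP; exists 1%g; rewrite ?dcoset1 ?group1.
Qed.

Lemma dcoset_sub_G w : w \in W -> dcoset w \subset G.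
Proof.
move=> /Weyl_ex[n nN ->]; apply/subsetP => x /(dcoset_cosetP _ nN)[b [c [bB cB ->]]].
by rewrite !groupM ?(subsetP sNG _ nN) ?(subsetP sBG).
Qed.

Lemma Parab_sub : Parab \subset G.
Proof. by apply/bigcupsP => u /parabW; exact: dcoset_sub_G. Qed.

Lemma card_Parab : #|Parab| = \sum_(u in WJ) #|dcoset u|.
Proof.
pose D u := if u \in WJ then dcoset u else set0.
have disj u v : u != v -> [disjoint D u & D v].
  move=> uv; rewrite -setI_eq0; apply: contraR uv => /set0Pn[x].
  rewrite inE /D; case: ifP; case: ifP; rewrite ?inE ?andbF // => vJ uJ /andP[xu xv].
  by apply/eqP; apply: dcoset_inj xu xv; apply: parabW.
rewrite /Parab big_mkcond -sum1_card (partition_disjoint_bigcup _ _ disj).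
rewrite [RHS]big_mkcond; apply: eq_bigr => u _; rewrite sum1_card /D.
by case: ifP => //; rewrite cards0.
Qed.

End ParabolicSubgroup.

Lemma parab_setT : parab sg setT = W.
Proof.
rewrite -genW /parab; congr <<_>>%g.
by apply/setP => x; apply/imsetP/imsetP => -[i _ ->]; exists i.
Qed.

Lemma Parab_setT : Parab setT = G.
Proof.
apply/eqP; rewrite eqEsubset Parab_sub {1}genG gen_subG subUset sub_Parab /=.
apply/subsetP => n nN; apply/ParabP; exists (coset T n); last exact: mem_dcoset.
by rewrite parab_setT cosetW.
Qed.

Variable q : nat.
Hypothesis card_BsB : forall i, #|(B * (s i *: B))%g| = q * #|B|.
Local Notation len := (wlen B N s).
Local Notation WJ J := (parab sg J).

Lemma asc_lt_len i w : w \in W -> asc i w = (len w < len (sg i * w)%g).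
Proof. exact: (ascE sWW sWM wlen_word wlen_ex asc_id asc_flip asc_fold). Qed.

Lemma desc_asc i w : w \in W -> ~~ asc i w -> asc i (sg i * w)%g.
Proof.
move=> wW na; have swW : (sg i * w)%g \in W := groupM (sWW i) wW.
rewrite asc_lt_len // (sgKl sWM).
by rewrite (desc_len sWW sWM wlen_word wlen_ex asc_id asc_fold wW na).
Qed.

Lemma wdesV w : w \in W -> wdes B N s (w^-1)%g = [set i | ~~ asc i w].
Proof.
move=> wW; apply/setP => i; rewrite !inE.
have swW : (sg i * w)%g \in W := groupM (sWW i) wW.
have -> : (w^-1 * sg i = (sg i * w)^-1)%g by rewrite invMg (sgV sWM).
have lV v : v \in W -> len v^-1%g = len v := lenV sWM wlen_word wlen_ex (w := v).
rewrite !lV //; case: (boolP (asc i w)) => [|na].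
  by rewrite asc_lt_len // => /ltnW; rewrite leqNgt => /negbTE.
by have := desc_asc wW na; rewrite asc_lt_len // (sgKl sWM).
Qed.

Lemma dcoset_sW i : dcoset (sg i) = (B * (s i *: B))%g.
Proof. by rewrite dcoset_coset // mulgA. Qed.

Lemma dcoset_stable w : left_stable B (dcoset w).
Proof. by move=> b x; apply: dcosetMl. Qed.

Lemma parab_set1 i : WJ [set i] = [set 1%g; sg i].
Proof. by rewrite /parab imset_set1; apply: cycle2g. Qed.

Lemma Parab_set1 i : Parab [set i] = B :|: dcoset (sg i).
Proof.
by rewrite /Parab parab_set1 bigcup_setU !big_set1 dcoset1.
Qed.

Lemma dcoset_disjoint u w : u \in W -> w \in W -> u != w ->
  [disjoint dcoset u & dcoset w].
Proof.
move=> uW wW; apply: contraNT; rewrite -setI_eq0 => /set0Pn[x /setIP[xu xw]].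
by apply/eqP; apply: dcoset_inj xu xw.
Qed.

(** * The 0-Hecke relations *)

Section HeckeMatrices.
Variable R : nzRingType.
Local Open Scope ring_scope.
Local Notation M w := (cmx G B R (dcoset w)).

Lemma Parab_set1_cmx i : cmx G B R (Parab [set i]) = 1%:M + M (sg i).
Proof.
have := dcoset_disjoint (group1 weyl_group) (sWW i).
rewrite eq_sym sW_neq1 dcoset1 => /(_ isT) d.
by rewrite Parab_set1 cmxU ?cmxB.
Qed.

(** Adding M w to both sides replaces M (sg i) by the operator of the group B U B s_i B, where
    [mul_cmx_unique] applies; its uniqueness condition is exactly the ascent. *)
Lemma asc_cmx i w : w \in W -> asc i w -> M w *m M (sg i) = M (sg i * w)%g.
Proof.
move=> wW a; have swW : (sg i * w)%g \in W := groupM (sWW i) wW.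
apply: (addrI (M w)); rewrite -{1}[M w]mulmx1 -mulmxDr -Parab_set1_cmx -cmxU; last first.
  apply: dcoset_disjoint => //; apply: contraTneq (asc_flip wW a) => <-.
  by rewrite a.
rewrite (mul_cmx_unique sBG R (K := Parab_group [set i])) //.
- congr cmx; apply/setP => y; apply/mulsgP/setUP.
    case=> h x /=; rewrite Parab_set1 => /setUP[hB|hs] xw ->; [left|right].
      exact: dcosetMl.
    exact: asc_mul.
  case=> [yw|ysw]; first by exists 1%g y; rewrite ?mul1g.
  have [h [x [hs xw ->]]] := dcoset_split (sWW i) wW ysw.
  by exists h x => //=; rewrite Parab_set1 inE hs orbT.
- exact: dcoset_sub_G.
- exact: dcoset_stable.
- exact: sub_Parab.
- exact: Parab_sub.
move=> h x /=; rewrite Parab_set1 => /setUP[//|hs] xw.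
by move/ascP: a => /(_ h x hs xw) /negbTE ->.
Qed.

Lemma sum_parab_cmx J : cmx G B R (Parab J) = \sum_(u in WJ J) M u.
Proof.
apply/matrixP => j k; rewrite summxE mxE; under eq_bigr do rewrite mxE.
case: (boolP (_ \in _)) => [/ParabP[u uJ yu]|ny].
  rewrite (bigD1 u) //= yu big1 ?addr0 // => v /andP[vJ vu].
  have := dcoset_disjoint (parabW vJ) (parabW uJ) vu.
  by rewrite disjoint_sym => /disjointFr ->.
rewrite big1 // => u uJ; case: (boolP (_ \in _)) => // yu.
by case/negP: ny; apply/ParabP; exists u.
Qed.

End HeckeMatrices.

(** * Sizes of Bruhat cells and indices of parabolic subgroups *)

Lemma dvdn_card_dcoset w : w \in W -> #|B| %| #|dcoset w|.
Proof.
move=> wW; rewrite -(card_reps sBG (dcoset_sub_G wW) (@dcoset_stable w)).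
exact: dvdn_mull.
Qed.

(* Row sums of the product formula, taken over int, count cosets. *)
Lemma card_dcoset_sW i w : w \in W -> asc i w ->
  #|dcoset (sg i * w)%g| = q * #|dcoset w|.
Proof.
move=> wW a; have swW : (sg i * w)%g \in W := groupM (sWW i) wW.
have := congr1 (mulmx^~ (const_mx 1%R : 'cV_(ncos G B))) (asc_cmx int wW a).
rewrite /= -mulmxA !cmx_row_sum ?dcoset_sub_G //; try exact: dcoset_stable; last exact: sWW.
rewrite dcoset_sW card_BsB mulnK ?cardG_gt0 //.
have -> : (const_mx q%:R = q%:R *: const_mx 1 :> 'cV[int]_(ncos G B))%R.
  by apply/matrixP => j o; rewrite !mxE mulr1.
rewrite -scalemxAr cmx_row_sum ?dcoset_sub_G //; last exact: dcoset_stable.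
(* A row index is needed to read an entry of the column identity. *)
have [j _] := rep_ex B (group1 G).
move=> /matrixP/(_ j 0%R); rewrite !mxE -natrM => /eqP; rewrite Num.Theory.eqr_nat => /eqP.
move=> e; rewrite -(divnK (dvdn_card_dcoset swW)) -(divnK (dvdn_card_dcoset wW)).
by rewrite -e mulnA.
Qed.

Lemma Weyl_asc_ind (P : coset_of T -> Prop) : P 1%g ->
    (forall i w, w \in W -> asc i w -> P w -> P (sg i * w)%g) ->
  forall w, w \in W -> P w.
Proof.
move=> P1 PM w wW; have [n] := ubnP (len w); elim: n w wW => // n IH w wW ltn.
have [[|i t] ew sz] := wlen_ex wW; first by rewrite -ew /wordW big_nil.
have uW : wordW B N s t \in W := wordW_in t.
have ewi : w = (sg i * wordW B N s t)%g by rewrite -ew /wordW big_cons.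
have lu : len (wordW B N s t) < len w by rewrite -sz ltnS wlen_word.
rewrite ewi; apply: PM => //; first by rewrite asc_lt_len // -ewi.
exact: IH uW (leq_trans lu ltn).
Qed.

Lemma card_dcoset w : w \in W -> #|dcoset w| = q ^ len w * #|B|.
Proof.
elim/Weyl_asc_ind: w / => [|i w wW a IH].
  by rewrite dcoset1 (len1 wlen_word) mul1n.
rewrite card_dcoset_sW // IH.
by rewrite (asc_len sWW sWM wlen_word wlen_ex asc_id asc_flip asc_fold) // expnS mulnA.
Qed.

Lemma index_Parab_B J : #|Parab J : B|%g = \sum_(u in WJ J) q ^ len u.
Proof.
rewrite -divgS ?sub_Parab //= card_Parab.
have -> : \sum_(u in WJ J) #|dcoset u| = (\sum_(u in WJ J) q ^ len u) * #|B|.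
  by rewrite big_distrl; apply: eq_bigr => u /parabW/card_dcoset.
by rewrite mulnK.
Qed.

(** After multiplication by |P_J : B|, the sum over W_J, the left side is |G : B|, the sum over W;
    [sum_len_factor] splits off the same positive factor. *)
Lemma index_Parab J :
  #|G : Parab J|%g = \sum_(d in W | [disjoint [set i | ~~ asc i d] & J]) q ^ len d.
Proof.
have sPG := Parab_sub J.
have pos : 0 < \sum_(u in WJ J) q ^ len u.
  by rewrite -index_Parab_B indexg_gt0.
apply/eqP; rewrite -(eqn_pmul2l pos) -{1}index_Parab_B mulnC.
rewrite Lagrange_index ?sub_Parab // -{1}Parab_setT index_Parab_B parab_setT.
rewrite (sum_len_factor sWW sWM wlen_word wlen_ex asc_id asc_flip asc_fold J).
apply/eqP; congr (_ * _); apply: eq_bigl => d; rewrite !inE; congr (_ && _).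
apply/forall_inP/pred0P => [ad i|dis i iJ].
  by rewrite /= inE andbC; case: (boolP (i \in J)) => //= /ad ->.
by have := dis i; rewrite /= inE iJ andbT => /negbFE.
Qed.

Lemma len_gt0 w : w \in W -> w != 1%g -> 0 < len w.
Proof.
by move=> wW; apply: contraNT; rewrite -eqn0Ngt => /eqP /(len_eq0 wlen_ex wW) ->.
Qed.

(** * Operators in the defining characteristic *)

Section Defining.
Variable F : fieldType.
Local Open Scope ring_scope.
Hypothesis q0 : q%:R = 0 :> F.
Local Notation M w := (cmx G B F (dcoset w)).
Local Notation E J := (cmx G B F (Parab J)).

Lemma Tmat_cmx i : Tmat G B s i = M (sg i).
Proof.
apply/matrixP => j k; rewrite !mxE !coset_of_idxE -dcoset_sW.
have -> : (dcoset (sg i) * (B :* rep j) = dcoset (sg i) :* rep j)%g.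
  by rewrite mulgA; congr (_ :* _)%g; rewrite /dcoset -mulgA mulGid.
congr (nat_of_bool _)%:R; apply/subsetP/idP => [sub|h _ /rcosetP[b bB ->]].
  by rewrite -mem_rcoset sub // rcoset_refl.
by rewrite mem_rcoset -mulgA dcosetMl.
Qed.

Lemma index_Parab_mod J : (#|Parab J : B|%g)%:R = 1 :> F.
Proof.
rewrite index_Parab_B natr_sum (bigD1 1%g) ?group1 //=.
rewrite (len1 wlen_word) big1 ?addr0 // => u /andP[uJ u1].
by rewrite natrX q0 expr0n eqn0Ngt len_gt0 // (parabW uJ).
Qed.

Lemma mul_cmx_Parab i (J : {set 'I_r}) : i \in J -> E [set i] *m E J = E J.
Proof.
move=> iJ; have sPP : Parab [set i] \subset Parab J.
  rewrite Parab_set1 subUset sub_Parab; apply/subsetP => x xs.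
  by apply/ParabP; exists (sg i); rewrite // sg_parab.
rewrite (mul_cmx_group sBG F (K := Parab_group [set i]) (P := Parab_group J)) //.
- by rewrite index_Parab_mod scale1r.
- exact: sub_Parab.
exact: Parab_sub.
Qed.

Lemma cmx_Parab_idem J : E J *m E J = E J.
Proof.
rewrite (mul_cmx_group sBG F (K := Parab_group J) (P := Parab_group J)) //.
- by rewrite index_Parab_mod scale1r.
- exact: sub_Parab.
exact: Parab_sub.
Qed.

Lemma sW_mul_cmx_Parab i (J : {set 'I_r}) : i \in J -> M (sg i) *m E J = 0.
Proof.
move=> /mul_cmx_Parab; rewrite Parab_set1_cmx mulmxDl mul1mx.
by move/(canRL (addKr _)) => ->; rewrite addNr.
Qed.

(** T_w ends with T_i because s_i w ascends to w, and T_i^2 = -T_i restates that 1 + T_i is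
    idempotent. *)
Lemma desc_cmx i w : w \in W -> ~~ asc i w -> M w *m M (sg i) = - M w.
Proof.
move=> wW na; have swW : (sg i * w)%g \in W := groupM (sWW i) wW.
have := asc_cmx F swW (desc_asc wW na); rewrite (sgKl sWM) => <-.
rewrite -mulmxA -mulmxN; congr (_ *m _).
have := cmx_Parab_idem [set i]; rewrite Parab_set1_cmx mulmxDl mul1mx.
move/(canRL (addKr _)); rewrite addNr mulmxDr mulmx1 => /eqP.
by rewrite addrC addr_eq0 => /eqP.
Qed.

Lemma hsub_cmx V w : hsub G B s V -> w \in W -> (V *m M w <= V)%MS.
Proof.
move=> /forallP hV; elim/Weyl_asc_ind: w / => [|i w wW a IH].
  by rewrite dcoset1 cmxB mulmx1.
rewrite -(asc_cmx F wW a) mulmxA -Tmat_cmx.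
exact: submx_trans (submxMr _ IH) (hV i).
Qed.

Lemma hsub_cmx_Parab V (J : {set 'I_r}) : hsub G B s V -> (V *m E J <= V)%MS.
Proof.
move=> hV; rewrite sum_parab_cmx mulmx_sumr; apply: summx_sub => u uJ.
by apply: hsub_cmx; rewrite // (parabW uJ).
Qed.

(** * Composition factors *)

Section CompositionSeries.
Variables (k : nat) (V : nat -> 'M[F]_(ncos G B)).
Hypothesis serV : comp_series G B s k V.

Lemma series_hsub j : (j <= k)%N -> hsub G B s (V j).
Proof. by case: serV => _ _ h _ _; apply: h. Qed.

Lemma series_lt j : (j < k)%N -> (V j < V j.+1)%MS.
Proof. by case: serV => _ _ _ h _; apply: h. Qed.

(* If w is of maximal length with v M_w outside V_j, then v M_w is modulo V_j
   a common eigenvector of all T_i. *)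
Lemma series_factor j : (j < k)%N -> exists D, factor_is_C G B s V D j.
Proof.
move=> jk; have hVj := series_hsub (ltnW jk); have hVj1 := series_hsub jk.
have /andP[sV nV] := series_lt jk.
have /row_subPn[i0 nv] := nV; set v := row i0 _ in nv.
have vV : (v <= V j.+1)%MS by apply: row_sub.
pose P w := (w \in W) && ~~ (v *m M w <= V j)%MS.
have P1 : P 1%g by rewrite /P (group1 weyl_group) dcoset1 cmxB mulmx1.
case: (arg_maxnP (fun w => len w) P1) => w /andP[wW nx] wmax.
set x := v *m M w in nx.
have xV : (x <= V j.+1)%MS := submx_trans (submxMr _ vV) (hsub_cmx hVj1 wW).
(* At a descent T_i negates x; at an ascent it gives v M_{s_i w}, which maximality puts in V_j. *)
exists [set i | ~~ asc i w].
have Vjc i (c : F) : (V j *m (Tmat G B s i - c%:M) <= V j)%MS.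
  by rewrite mulmxBr mul_mx_scalar addmx_sub ?eqmx_opp ?scalemx_sub // (forallP hVj i).
have xc i : (x *m (Tmat G B s i - (if i \in [set i | ~~ asc i w] then -1 else 0)%:M)
               <= V j)%MS.
  rewrite inE Tmat_cmx mulmxBr mul_mx_scalar /x -mulmxA.
  case: (boolP (asc i w)) => a /=.
    rewrite scale0r subr0 asc_cmx //; apply: contraT => nsw.
    have swW : (sg i * w)%g \in W := groupM (sWW i) wW.
    have := wmax (sg i * w)%g; rewrite /P swW nsw => /(_ isT).
    by rewrite /= leqNgt -asc_lt_len // a.
  by rewrite desc_cmx // mulmxN scaleN1r opprK addNr sub0mx.
(* U is a submodule strictly above V_j, hence V_{j+1} by simplicity, and one row raises the rank by
   one. *)
pose U := (V j + x)%MS.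
have sVU : (V j <= U)%MS by apply: addsmxSl.
have hU : hsub G B s U.
  apply/forallP => i; rewrite {1}/U addsmxMr addsmx_sub.
  rewrite (submx_trans (forallP hVj i) sVU) /=.
  rewrite -[Tmat G B s i](subrK (if i \in [set i | ~~ asc i w] then -1 else 0)%:M).
  rewrite mulmxDr mul_mx_scalar addmx_sub ?(submx_trans (xc i) sVU) //.
  by rewrite scalemx_sub // addsmxSr.
have sUV : (U <= V j.+1)%MS by rewrite addsmx_sub sV.
have eU : (V j.+1 <= U)%MS.
  case: serV => _ _ _ _ /(_ j jk U hU sVU sUV)/orP[/andP[UV _]|/andP[_ //]].
  by case/negP: nx; apply: submx_trans UV; apply: addsmxSr.
apply/andP; split.
  rewrite eqn_leq (rank_ltmx (series_lt jk)) andbT (leq_trans (mxrankS eU)) //.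
  by rewrite (leq_trans (mxrank_adds_leqif _ _)) // -(addn1 (\rank (V j))) leq_add2l rank_leq_row.
apply/forallP => i; apply: submx_trans (submxMr _ eU) _.
by rewrite addsmxMr addsmx_sub Vjc xc.
Qed.

(** For i in D outside D', T_i + 1 and T_i would both map V_{j+1} into V_j, and so would their
    difference, the identity. *)
Lemma series_factor_sub j D D' : (j < k)%N ->
  factor_is_C G B s V D j -> factor_is_C G B s V D' j -> D \subset D'.
Proof.
move=> jk /andP[_ /forallP fD] /andP[_ /forallP fD'].
have /andP[_ nV] := series_lt jk.
apply/subsetP => i iD; apply: contraNT nV => /negbTE niD'.
have := fD i; have := fD' i; rewrite iD niD' => h0 h1.
have -> : V j.+1 = V j.+1 *m (Tmat G B s i - (-1)%:M) - V j.+1 *m (Tmat G B s i - 0%:M).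
  by rewrite -mulmxBr raddf0 subr0 raddfN opprK addrC addKr mulmx1.
by rewrite addmx_sub ?eqmx_opp.
Qed.

Lemma series_factor_uniq j D D' : (j < k)%N ->
  factor_is_C G B s V D j -> factor_is_C G B s V D' j -> D = D'.
Proof.
by move=> jk fD fD'; apply/eqP; rewrite eqEsubset !(series_factor_sub jk).
Qed.

(** E_J - 1 is the sum of T_u over u != 1 in W_J. Each such u has a left descent i in J, so T_u ends
    with T_i, which is 0 on the factor. *)
Lemma factor_Parab_disjoint j D (J : {set 'I_r}) : (j < k)%N -> factor_is_C G B s V D j ->
  [disjoint D & J] -> (V j.+1 *m (E J - 1%:M) <= V j)%MS.
Proof.
move=> jk /andP[_ /forallP fD] dDJ; have hV := series_hsub jk.
rewrite sum_parab_cmx (bigD1 1%g) ?group1 //= dcoset1 cmxB addrAC subrr add0r mulmx_sumr.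
apply: summx_sub => u /andP[uJ u1]; have uW := parabW uJ.
have [i iJ na] := parab_desc sWW sWM wlen_word wlen_ex asc_id asc_flip asc_fold uJ u1.
have swW : (sg i * u)%g \in W := groupM (sWW i) uW.
have := asc_cmx F swW (desc_asc uW na); rewrite (sgKl sWM) => <-.
rewrite mulmxA; apply: submx_trans (submxMr _ (hsub_cmx hV swW)) _.
have := fD i; rewrite Tmat_cmx.
have -> : (i \in D) = false by apply/negbTE/negP => /(disjointFr dDJ); rewrite iJ.
by rewrite raddf0 subr0.
Qed.

(** For i in both D and J, T_i E_J = 0 gives E_J = (T_i + 1) E_J, and T_i + 1 already maps V_{j+1}
    into V_j. *)
Lemma factor_Parab_meet j D (J : {set 'I_r}) : (j < k)%N -> factor_is_C G B s V D j ->
  ~~ [disjoint D & J] -> (V j.+1 *m E J <= V j)%MS.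
Proof.
move=> jk /andP[_ /forallP fD]; rewrite -setI_eq0 => /set0Pn[i /setIP[iD iJ]].
have := fD i; rewrite iD Tmat_cmx => h.
have -> : E J = (M (sg i) - (-1)%:M) *m E J.
  by rewrite mulmxBl sW_mul_cmx_Parab // mul_scalar_mx scaleN1r opprK add0r.
rewrite mulmxA; apply: submx_trans (submxMr _ h) _.
exact: hsub_cmx_Parab (series_hsub (ltnW jk)).
Qed.

(** Kernels grow with the subspace, so the rank rises by at most one. If D meets J, idempotence puts
    V_{j+1} E_J inside V_j E_J. Otherwise equal images would place V_{j+1} E_J, and with it V_{j+1},
    inside V_j. *)
Lemma rank_series_Parab j D (J : {set 'I_r}) : (j < k)%N -> factor_is_C G B s V D j ->
  \rank (V j.+1 *m E J) = ([disjoint D & J] + \rank (V j *m E J))%N.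
Proof.
move=> jk fD; have /andP[sV nV] := series_lt jk.
have sVE : (V j *m E J <= V j.+1 *m E J)%MS by apply: submxMr.
apply/eqP; rewrite eqn_leq; case: (boolP [disjoint D & J]) => dDJ; last first.
  rewrite add0n (mxrankS sVE) andbT -{1}(cmx_Parab_idem J) mulmxA mxrankS //.
  by rewrite submxMr // (factor_Parab_meet jk fD).
apply/andP; split.
  have /andP[/eqP rk _] := fD.
  have := mxrank_mul_ker (V j.+1) (E J); rewrite rk -(mxrank_mul_ker (V j) (E J)).
  have : (\rank (V j :&: kermx (E J)) <= \rank (V j.+1 :&: kermx (E J)))%N.
    by rewrite mxrankS // capmxS.
  by move=> le eq1; rewrite -(leq_add2r (\rank (V j.+1 :&: kermx (E J)))) eq1 !addSn ltnS
    leq_add2l.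
have ltE : (V j *m E J < V j.+1 *m E J)%MS.
  rewrite /ltmx sVE; apply: contra nV => sE.
  have -> : V j.+1 = V j.+1 *m E J - V j.+1 *m (E J - 1%:M).
    by rewrite mulmxBr mulmx1 subKr.
  rewrite addmx_sub ?eqmx_opp ?(factor_Parab_disjoint jk fD) //.
  apply: submx_trans sE _; exact: hsub_cmx_Parab (series_hsub (ltnW jk)).
by rewrite add1n rank_ltmx.
Qed.

Lemma index_Parab_factors (Dj : 'I_k -> {set 'I_r}) J :
    (forall j : 'I_k, factor_is_C G B s V (Dj j) j) ->
  #|G : Parab J|%g = (\sum_(j < k) [disjoint Dj j & J])%N.
Proof.
move=> fD; case: serV => V0 Vk _ _ _.
rewrite -(rank_cmx sBG F (P := Parab_group J)) ?sub_Parab ?Parab_sub //=.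
have -> : \rank (E J) = \rank (V k *m E J).
  by rewrite (eqmxMr _ (eqmxP Vk)) mul1mx.
have DjE (a b : 'I_k) : a = b :> nat ->
    [disjoint Dj a & J] = [disjoint Dj b & J] :> nat by move/val_inj ->.
suff H n (nk : (n <= k)%N) : \rank (V n *m E J) =
    (\sum_(j < n) [disjoint Dj (widen_ord nk j) & J])%N.
  by rewrite (H k (leqnn k)); apply: eq_bigr => j _; apply: DjE.
elim: n nk => [|n IH] nk.
  by rewrite big_ord0 (eqmxMr _ (eqmxP V0)) mul0mx mxrank0.
rewrite big_ord_recr /= addnC (rank_series_Parab _ nk (fD (Ordinal nk))) (IH (ltnW nk)).
by congr (_ + _)%N; [apply: DjE | apply: eq_bigr => j _; apply: DjE].
Qed.

(** Each factor has exactly one set [Dj j], so multiplicities are fibre sizes of [Dj]; for every J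
    both families sum to |G : P_J| over the sets disjoint from J. *)
Lemma mult_C_sum D : mult_C G B s k V D =
  (\sum_(w in W | wdes B N s (w^-1)%g == D) q ^ len w)%N.
Proof.
have /fin_all_exists[Dj fD] (j : 'I_k) := series_factor (ltn_ord j).
have -> : mult_C G B s k V D = (\sum_(j | Dj j == D) 1)%N.
  rewrite /mult_C -sum1_card; apply: eq_bigl => j; rewrite inE.
  by apply/idP/eqP => [fDj|<- //]; apply: series_factor_uniq (fD j) fDj.
have -> : (\sum_(w in W | wdes B N s (w^-1)%g == D) q ^ len w =
           \sum_(w in W | [set i | ~~ asc i w] == D) q ^ len w)%N.
  by apply: eq_bigl => w; case: (boolP (w \in W)) => //= wW; rewrite wdesV.
move: D; apply: eq_from_disjoint_sums => J.
rewrite (sum_fibres xpredT Dj) sum_fibres -index_Parab.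
by rewrite (index_Parab_factors J fD) big_mkcond; apply: eq_bigr => j _; case: [disjoint _ & _].
Qed.

End CompositionSeries.
End Defining.
End TitsSystem.

Theorem theorem6p4 (F : fieldType) (p e : nat) (gT : finGroupType)
    (G B N : {group gT}) (r : nat) (s : 'I_r -> gT) :
  prime p -> 0 < e -> (p \in [pchar F])%R ->
  lie_type_BN G B N s p (p ^ e) ->
  forall alpha : seq nat, is_composition r.+1 alpha ->
  forall (k : nat) (V : nat -> 'M[F]_(ncos G B)),
    comp_series G B s k V ->
    mult_C G B s k V (Dcomp r alpha) =
      (\sum_(w in Weyl B N | wdes B N s (w^-1)%g == Dcomp r alpha)
          (p ^ e) ^ wlen B N s w)%N.
Proof.
move=> _ e0 pF [[sBG sNG genG] [nTN sN genW] [o2 _ tits] [sBs cBsB _ _]] alpha _ k V serV.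
(* A positive exponent makes q a multiple of p, hence zero in F. *)
have q0 : ((p ^ e)%:R = 0 :> F)%R.
  by rewrite natrX (pcharf0 pF) expr0n eqn0Ngt e0.
exact: (mult_C_sum sBG sNG genG nTN sN genW o2 tits sBs cBsB q0 serV).
Qed.
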